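(* Let $ABCD$ be a cyclic quadrilateral in the Euclidean plane with four distinct vertices on a circle $\Gamma$, and let $\Sigma$ be a (non-degenerate) rectangular hyperbola passing through $A,B,C,D$. Let $P$ be a point of $\Sigma$ different from $A,B,C,D$ and different from the orthocentres of the triangles $\Delta_1=BCD$, $\Delta_2=ACD$, $\Delta_3=ABD$, $\Delta_4=ABC$. For $k=1,2,3,4$ let $\Gamma_k$ be the Hagge circle of $P$ with respect to $\Delta_k$, and let $Q_k$ be the centre of $\Gamma_k$. Then the four points $Q_1,Q_2,Q_3,Q_4$ are collinear.
   Context: Hagge circle: let $XYZ$ be a triangle with circumcircle $\Gamma$ and let $P$ be a point not on $\Gamma$ and not on the side lines. Let $X',Y',Z'$ be the second intersections of the lines $XP,YP,ZP$ with $\Gamma$ (if such a line is tangent to $\Gamma$ at the vertex, the second intersection is the vertex itself). Let $U,V,W$ be the reflections of $X',Y',Z'$ in the lines $YZ,ZX,XY$ respectively. When $P$ is not the orthocentre of $XYZ$, the Hagge circle of $P$ with respect to $XYZ$ is the circle through $U,V,W$; it is known that it also passes through the orthocentre of $XYZ$. A rectangular hyperbola is a hyperbola whose asymptotes are perpendicular. All four triangles $\Delta_k$ have the same circumcircle $\Gamma$. *)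

(* Defs.v *)
From Stdlib Require Import Reals.
Open Scope R_scope.

Definition point : Type := (R * R)%type.

Definition padd (u v : point) : point := (fst u + fst v, snd u + snd v).
Definition psub (u v : point) : point := (fst u - fst v, snd u - snd v).
Definition pscale (t : R) (u : point) : point := (t * fst u, t * snd u).
Definition dot (u v : point) : R := fst u * fst v + snd u * snd v.
Definition rot90 (u : point) : point := (- snd u, fst u).
Definition dist (M N : point) : R := dist_euc (fst M) (snd M) (fst N) (snd N).
Definition midpoint (M N : point) : point := pscale (/ 2) (padd M N).

(** [line_dir] is meant to be nonzero; with a zero direction the carrier is the
    single point [line_base]. *)
Record line : Type := Line { line_base : point; line_dir : point }.

Definition on_line (l : line) (M : point) : Prop :=
  exists t : R, M = padd (line_base l) (pscale t (line_dir l)).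

Definition line_through (M N : point) : line := Line M (psub N M).

Definition perpendicular (l m : line) : Prop :=
  dot (line_dir l) (line_dir m) = 0.

Definition collinear4 (M1 M2 M3 M4 : point) : Prop :=
  exists l : line, line_dir l <> (0, 0) /\
    on_line l M1 /\ on_line l M2 /\ on_line l M3 /\ on_line l M4.

Definition is_reflection (l : line) (M N : point) : Prop :=
  on_line l (midpoint M N) /\ dot (psub N M) (line_dir l) = 0.

Definition is_orthocentre (X Y Z H : point) : Prop :=
  dot (psub H X) (psub Y Z) = 0 /\
  dot (psub H Y) (psub Z X) = 0 /\
  dot (psub H Z) (psub X Y) = 0.

Record circle : Type := Circle {
  centre : point;
  radius : R;
  radius_pos : 0 < radius }.

Definition on_circle (G : circle) (M : point) : Prop :=
  dist (centre G) M = radius G.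

Definition is_circumcircle (X Y Z : point) (G : circle) : Prop :=
  on_circle G X /\ on_circle G Y /\ on_circle G Z.

Definition tangent_at (l : line) (G : circle) (M : point) : Prop :=
  on_line l M /\ on_circle G M /\
  forall N : point, on_line l N -> on_circle G N -> N = M.

(** For [X] on [G] and [P <> X], [N] is the second intersection of the line [XP]
    with [G]. *)
Definition is_second_intersection (G : circle) (X P N : point) : Prop :=
  on_line (line_through X P) N /\ on_circle G N /\
  (N <> X \/ (N = X /\ tangent_at (line_through X P) G X)).

(** The notion is meant for [P] off the circumcircle and off the side lines of
    the triangle [XYZ], and different from its orthocentre; then [K] exists and
    is unique. *)
Definition is_Hagge_circle (X Y Z P : point) (K : circle) : Prop :=
  exists (G : circle) (X' Y' Z' U V W : point),
    is_circumcircle X Y Z G /\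
    is_second_intersection G X P X' /\
    is_second_intersection G Y P Y' /\
    is_second_intersection G Z P Z' /\
    is_reflection (line_through Y Z) X' U /\
    is_reflection (line_through Z X) Y' V /\
    is_reflection (line_through X Y) Z' W /\
    on_circle K U /\ on_circle K V /\ on_circle K W.

(** A (non-degenerate) hyperbola, given by its centre, a unit vector along the
    transverse axis, and its semi-axes. *)
Record hyperbola : Type := Hyperbola {
  hyp_centre : point;
  hyp_axis : point;
  semi_a : R;
  semi_b : R;
  hyp_axis_unit : dot hyp_axis hyp_axis = 1;
  semi_a_pos : 0 < semi_a;
  semi_b_pos : 0 < semi_b }.

(** x^2 / a^2 - y^2 / b^2 = 1 in the orthonormal frame of the axes. *)
Definition on_hyperbola (S : hyperbola) (M : point) : Prop :=
  let v := psub M (hyp_centre S) in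
  let x := dot v (hyp_axis S) in
  let y := dot v (rot90 (hyp_axis S)) in
  x ^ 2 / semi_a S ^ 2 - y ^ 2 / semi_b S ^ 2 = 1.

(** The lines y = (b / a) x and y = - (b / a) x in the same frame. *)
Definition asymptote1 (S : hyperbola) : line :=
  Line (hyp_centre S)
    (padd (pscale (semi_a S) (hyp_axis S))
          (pscale (semi_b S) (rot90 (hyp_axis S)))).

Definition asymptote2 (S : hyperbola) : line :=
  Line (hyp_centre S)
    (psub (pscale (semi_a S) (hyp_axis S))
          (pscale (semi_b S) (rot90 (hyp_axis S)))).

Definition rectangular (S : hyperbola) : Prop :=
  perpendicular (asymptote1 S) (asymptote2 S).

(* Main.v *)
From Stdlib Require Import Reals Lra.
From Coquelicot Require Import Coquelicot.
Require Import Defs.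

(** Take the centre of the circle [Gamma] as origin of the complex plane and let
    [k] be the square of its radius, so that a vertex [x] satisfies
    [x x^* = k]. For a triangle [x, y, z] the chord and reflection formulas give
    the point [U] of the Hagge construction attached to [x] as
      [u = p + m / (k (x - p))],
      [m = k (p^2 - s1 p + s2) - s3 p^*],
    where [s1, s2, s3] are the elementary symmetric functions of [x, y, z]
    ([hagge_point_inversion]). As [m] is symmetric, the three points are the
    images of the vertices under one inversion-like map, and the Hagge circle is
    the image of [Gamma]. Its centre [q] is therefore given by
      [k (k - |p|^2) (q - p) = p^* m]   ([hagge_centre]),
    where [m <> 0] because [p] is neither a vertex nor the orthocentre [s1].

    Now let a fourth point [w] of [Gamma] complete the triangle to a
    quadrilateral [a, b, c, d]. The combination [k^2 m + a b c d m^*] is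
    symmetric in all four vertices ([hagge_coeff_conj_symmetric]), hence is the
    same for the four triangles. Put [delta = (a - b) (c - d)], for which
    [k^2 delta = a b c d delta^*]. Multiplying the combination by [delta^*]
    says that the scalar product of [m] and [delta] is the same for the four
    triangles, so the four centres lie on a line of normal [p^* delta]. When [p]
    is the origin this normal vanishes, but then all four centres are at [p].

    The common value of [k^2 m + a b c d m^*] is, up to the factor [k], the left
    side of the equation of the rectangular hyperbola through [a, b, c, d],
    evaluated at [p]: for [p] on that hyperbola the line of centres passes
    through [p]. *)

Open Scope R_scope.

(** * Complex coordinates *)

Local Open Scope C_scope.
Local Notation "z ^*" := (Cconj z) (at level 2, format "z ^*").

Ltac push_conj :=
  repeat rewrite ?Cplus_conj, ?Cminus_conj, ?Copp_conj, ?Cmult_conj, ?Cconj_conj.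

Lemma Cconj_RtoC (t : R) : (RtoC t)^* = t.
Proof. unfold Cconj, RtoC; simpl; f_equal; ring. Qed.

Lemma Cmult_eq_0 (z w : C) : z * w = 0 -> z = 0 \/ w = 0.
Proof.
  intros H. destruct (Ceq_dec z 0) as [|Hz]; [now left|].
  destruct (Ceq_dec w 0) as [|Hw]; [now right|].
  now destruct (Cmult_neq_0 z w Hz Hw).
Qed.

Lemma Cmult_cancel_l (z u v : C) : z <> 0 -> z * u = z * v -> u = v.
Proof.
  intros Hz H. destruct (Cmult_eq_0 z (u - v)) as [|E]; [|easy|].
  - replace (z * (u - v)) with (z * u - z * v) by ring. rewrite H; ring.
  - replace u with (u - v + v) by ring. rewrite E; ring.
Qed.

Lemma dot_conj (u v : C) : RtoC (2 * dot u v) = u * v^* + u^* * v.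
Proof.
  unfold dot, Cconj, Cmult, Cplus, RtoC; simpl; f_equal; ring.
Qed.

Lemma dot_eq_conj (u v u' v' : C) :
  u * v^* + u^* * v = u' * v'^* + u'^* * v' -> dot u v = dot u' v'.
Proof. rewrite <- !dot_conj. intros H. injection H. lra. Qed.

Lemma on_circle_conj (G : circle) (M : C) :
  on_circle G M <->
  (M - centre G) * (M - centre G)^* = RtoC (radius G * radius G).
Proof.
  pose proof (radius_pos G) as Hr.
  unfold on_circle, dist, dist_euc.
  assert (E : (M - centre G) * (M - centre G)^* =
    RtoC (Rsqr (fst (centre G) - fst M) + Rsqr (snd (centre G) - snd M))).
  { unfold Rsqr, Cconj, Cmult, Cminus, Cplus, Copp, RtoC; simpl; f_equal; ring. }
  rewrite E. split.
  - intros <-. rewrite sqrt_sqrt; [easy|].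
    apply Rplus_le_le_0_compat; apply Rle_0_sqr.
  - intros H. injection H as H. rewrite H. apply sqrt_square. lra.
Qed.

(** * Circles through three points *)

(** On the circle [x x^* = k] one has [x w (w - x)^* = - k (w - x)]. A chord
    from [x] to [w] orthogonal to [n] thus gives [n^* x w = n k], and two such
    chords from the same [x] force [n = 0]. *)
Lemma circle_not_collinear (k x y z n : C) :
  x * x^* = k -> y * y^* = k -> z * z^* = k -> x <> y -> x <> z -> y <> z ->
  n * (y - x)^* + n^* * (y - x) = 0 ->
  n * (z - x)^* + n^* * (z - x) = 0 -> n = 0.
Proof.
  intros Hx Hy Hz xy xz yz.
  assert (key : forall w, w * w^* = k -> x <> w ->
    n * (w - x)^* + n^* * (w - x) = 0 -> n^* * x * w = n * k).
  { intros w Hw xw H. apply Cmult_cancel_l with (w - x).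
    { apply Cminus_eq_contra; congruence. }
    transitivity (x * w * (n * (w - x)^* + n^* * (w - x))
      + n * w * (x * x^*) - n * x * (w * w^*)); [push_conj; ring|].
    rewrite H, Hx, Hw; ring. }
  intros Ny Nz. apply key in Ny; try easy. apply key in Nz; try easy.
  destruct (Cmult_eq_0 (n^* * x) (y - z)) as [E|E].
  - replace (n^* * x * (y - z)) with (n^* * x * y - n^* * x * z) by ring.
    rewrite Ny, Nz; ring.
  - apply Cmult_eq_0 in E as [E|E].
    + rewrite <- (Cconj_conj n), E. apply Cconj_RtoC.
    + (* a circle of radius zero does not have two points *)
      rewrite <- Hx, E, Cmult_0_l in Hy.
      apply Cmult_eq_0 in Hy as [Hy|Hy]; [congruence|].
      destruct xy. rewrite E, <- (Cconj_conj y), Hy, Cconj_RtoC. easy.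
  - now destruct (Cminus_eq_contra y z).
Qed.

(** The equation [s |M - o|^2 + 2 n . (M - o) = g] describes a circle, or a line
    if [s = 0]. Subtracting [s] times the equation of [K] leaves an equation
    linear in [M], which three distinct points of [K] satisfy only if it is
    trivial. With [s = 0] allowed, the lemma also shows that [K] does not meet a
    line in three points. *)
Lemma circle_centre_of_equation (K : circle) (U V W o s n g : C) :
  on_circle K U -> on_circle K V -> on_circle K W ->
  U <> V -> U <> W -> V <> W -> s^* = s ->
  s * ((U - o) * (U - o)^*) + n * (U - o)^* + n^* * (U - o) = g ->
  s * ((V - o) * (V - o)^*) + n * (V - o)^* + n^* * (V - o) = g ->
  s * ((W - o) * (W - o)^*) + n * (W - o)^* + n^* * (W - o) = g ->
  n + s * (centre K - o) = 0.
Proof.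
  rewrite !on_circle_conj. set (q := centre K : C).
  intros KU KV KW UV UW VW sR EU EV EW.
  assert (shift : forall M N : C, M <> N -> M - q <> N - q).
  { intros M N H E. apply H.
    replace M with (M - q + q) by ring. rewrite E. ring. }
  assert (key : forall M, (M - q) * (M - q)^* = RtoC (radius K * radius K) ->
    s * ((M - o) * (M - o)^*) + n * (M - o)^* + n^* * (M - o) = g ->
    (n + s * (q - o)) * (M - q - (U - q))^*
      + (n + s * (q - o))^* * (M - q - (U - q)) = 0).
  { intros M KM EM.
    transitivity ((s * ((M - o) * (M - o)^*) + n * (M - o)^* + n^* * (M - o))
      - (s * ((U - o) * (U - o)^*) + n * (U - o)^* + n^* * (U - o))
      - s * ((M - q) * (M - q)^* - (U - q) * (U - q)^*)).
    - push_conj. rewrite sR. ring.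
    - rewrite EM, EU, KM, KU; ring. }
  apply (circle_not_collinear _ _ _ _ _ KU KV KW); auto.
Qed.

Lemma circle_eq_of_three_points (G K : circle) (X Y Z : C) :
  X <> Y -> X <> Z -> Y <> Z ->
  on_circle G X -> on_circle G Y -> on_circle G Z ->
  on_circle K X -> on_circle K Y -> on_circle K Z ->
  centre K = centre G /\ radius K = radius G.
Proof.
  intros XY XZ YZ GX GY GZ KX KY KZ.
  set (o := centre G : C). set (q := centre K : C).
  assert (key : forall M : C, on_circle G M ->
    1 * ((M - o) * (M - o)^*) + 0 * (M - o)^* + 0^* * (M - o)
      = RtoC (radius G * radius G)).
  { intros M H. apply on_circle_conj in H. rewrite <- H. fold o.
    rewrite Cconj_RtoC. ring. }
  assert (E : q = o).
  { pose proof (circle_centre_of_equation K X Y Z o 1 0 _ KX KY KZ XY XZ YZ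
      (Cconj_RtoC 1) (key X GX) (key Y GY) (key Z GZ)) as H.
    fold q in H. transitivity (0 + 1 * (q - o) + o); [ring|].
    rewrite H; ring. }
  split; [exact E|].
  unfold on_circle in GX, KX. rewrite <- GX, <- KX.
  change (dist q X = dist o X). now rewrite E.
Qed.

(** * The points of the Hagge construction *)

(** A point [X + s d] of the line, with [d = P - X], is on [G] iff [s = 0] or
    [s] is the root of an affine function. The second intersection is that root,
    and tangency means that the root is [0], so both clauses of
    [is_second_intersection] lead to one formula. *)
Lemma second_intersection_conj (G : circle) (X P N : C) :
  P <> X -> on_circle G X -> is_second_intersection G X P N ->
  (N - centre G) * (P - X)^* = (X - centre G)^* * (X - P).
Proof.
  intros PX GX [[t Ht] [GN HN]]. cbn [line_base line_dir line_through] in Ht.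
  change (N = X + pscale t (P - X)) in Ht.
  assert (scaleE : forall (s : R) (v : C), pscale s v = s * v).
  { intros s v. unfold pscale, RtoC, Cmult; simpl; f_equal; ring. }
  rewrite scaleE in Ht.
  set (o := centre G : C) in *. set (d := P - X) in *.
  assert (Hd : d <> 0) by now apply Cminus_eq_contra.
  assert (Hdd : d * d^* <> 0).
  { apply Cmult_neq_0; [easy|]. intros E. apply Hd.
    rewrite <- (Cconj_conj d), E. apply Cconj_RtoC. }
  assert (chord : forall s : R, on_circle G (X + s * d) <->
    s * ((X - o) * d^* + (X - o)^* * d + s * (d * d^*)) = 0).
  { intros s. rewrite !on_circle_conj. apply on_circle_conj in GX.
    fold o in GX |- *. rewrite <- GX.
    assert (E : (X + s * d - o) * (X + s * d - o)^* =
      (X - o) * (X - o)^* + s * ((X - o) * d^* + (X - o)^* * d + s * (d * d^*))).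
    { push_conj. rewrite Cconj_RtoC. ring. }
    rewrite E. split; intros H.
    - transitivity ((X - o) * (X - o)^* + s * ((X - o) * d^* + (X - o)^* * d
        + s * (d * d^*)) - (X - o) * (X - o)^*); [ring|]. rewrite H; ring.
    - rewrite H; ring. }
  assert (key : (X - o) * d^* + (X - o)^* * d + t * (d * d^*) = 0).
  { destruct HN as [NX|[NX [_ [_ tang]]]].
    - rewrite Ht in GN. apply chord, Cmult_eq_0 in GN as [E|E]; [|easy].
      destruct NX. rewrite Ht, E.
      change (@eq C (X + 0 * d) X). ring.
    - assert (T0 : RtoC t = 0).
      { rewrite NX in Ht.
        destruct (Cmult_eq_0 t d) as [E|E]; [|easy|easy].
        transitivity (X + t * d - X); [ring|]. rewrite <- Ht; ring. }
      (* Tangency is used at the root s of the second factor. *)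
      set (s := (- (2 * dot (X - o)%C d / dot d d))%R).
      assert (Hs : (X - o) * d^* + (X - o)^* * d + s * (d * d^*) = 0).
      { assert (dd : d * d^* = RtoC (dot d d)).
        { unfold dot, Cconj, Cmult, RtoC; simpl; f_equal; ring. }
        rewrite <- dot_conj, dd, <- RtoC_mult, <- RtoC_plus.
        f_equal. unfold s. field. intros D. apply Hdd. now rewrite dd, D. }
      assert (S0 : @eq C (X + s * d) X).
      { apply tang.
        - exists s. unfold line_through; cbn [line_base line_dir].
          change (X + s * d = X + pscale s d). now rewrite scaleE.
        - apply chord. rewrite Hs; ring. }
      assert (S1 : RtoC s = 0).
      { destruct (Cmult_eq_0 s d) as [E|E]; [|easy|easy].
        transitivity (X + s * d - X); [ring|]. rewrite S0; ring. }
      rewrite T0. rewrite S1 in Hs. exact Hs. }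
  replace (X - P) with (- d) by (unfold d; ring).
  transitivity ((X - o) * d^* + (X - o)^* * d + t * (d * d^*)
    - (X - o)^* * d); [rewrite Ht; ring|]. rewrite key. ring.
Qed.

(** The usual [u = y + z - y z / n], multiplied by [k]: the conjugate of [n]
    replaces [k / n], so that [N] may be any point of the plane. *)
Lemma reflection_in_chord (Y Z N U o k : C) :
  Y <> Z -> (Y - o) * (Y - o)^* = k -> (Z - o) * (Z - o)^* = k ->
  is_reflection (line_through Y Z) N U ->
  k * (U - o) = k * (Y - o + (Z - o)) - (Y - o) * (Z - o) * (N - o)^*.
Proof.
  intros YZ HY HZ [[t Ht] Hperp].
  cbn [line_base line_dir line_through] in Ht, Hperp.
  assert (E1 : N + U = 2 * Y + 2 * (t * (Z - Y))).
  { apply (f_equal (fun M : C => 2 * M)) in Ht.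
    transitivity (2 * (midpoint N U : C)).
    - unfold midpoint, pscale, padd, Cmult, Cplus, RtoC; simpl.
      f_equal; field.
    - rewrite Ht.
      unfold pscale, padd, psub, Cmult, Cminus, Copp, Cplus, RtoC; simpl.
      f_equal; ring. }
  assert (E2 : (U - N) * (Z - Y)^* + (U - N)^* * (Z - Y) = 0).
  { rewrite <- dot_conj. change (RtoC (2 * dot (psub U N) (psub Z Y)) = 0).
    rewrite Hperp. f_equal; ring. }
  set (y := Y - o) in *. set (z := Z - o) in *.
  replace (Z - Y) with (z - y) in * by (unfold y, z; ring).
  assert (zy : z - y <> 0).
  { replace (z - y) with (Z - Y) by (unfold y, z; ring).
    apply Cminus_eq_contra; congruence. }
  assert (E3 : (U - o - y) * (z - y)^* = ((N - o)^* - y^*) * (z - y)).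
  { apply Cmult_cancel_l with (RtoC 2); [intros E; injection E; lra|].
    pose proof (f_equal Cconj E1) as E1c.
    revert E1c. push_conj. rewrite !Cconj_RtoC. intros E1c.
    assert (F1 : U = 2 * Y + 2 * (t * (z - y)) - N).
    { rewrite <- E1; ring. }
    assert (F1c : U^* = 2 * Y^* + 2 * (t * (z^* - y^*)) - N^*).
    { rewrite <- E1c; ring. }
    revert E2. push_conj. intros E2.
    replace Y with (y + o) in F1 by (unfold y; ring).
    replace (Y^*) with (y^* + o^*) in F1c
      by (unfold y; push_conj; ring).
    transitivity (2 * (((N - o)^* - y^*) * (z - y))
      + ((U - N) * (z^* - y^*) + (U^* - N^*) * (z - y))
      + (U - (2 * (y + o) + 2 * (t * (z - y)) - N)) * (z^* - y^*)
      - (U^* - (2 * (y^* + o^*) + 2 * (t * (z^* - y^*)) - N^*)) * (z - y)).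
    - push_conj. ring.
    - rewrite E2. rewrite <- F1, <- F1c. push_conj. ring. }
  apply Cmult_cancel_l with (z - y); [easy|].
  (* k (z - y) = - y z (z - y)^* turns the conjugate direction of the chord
     into the direction itself. *)
  assert (E4 : k * (z - y) = - (y * z * (z - y)^*)).
  { transitivity (y * y^* * z - z * z^* * y).
    - rewrite HY, HZ; ring.
    - push_conj; ring. }
  transitivity (k * (z - y) * y - y * z * ((U - o - y) * (z - y)^*)).
  - transitivity (k * (z - y) * y + k * (z - y) * (U - o - y)); [ring|].
    rewrite E4; ring.
  - rewrite E3.
    transitivity ((z - y) * (k * y + z * (y * y^*) - y * z * (N - o)^*)); [ring|].
    rewrite HY; ring.
Qed.

(** The numerator [m] of the map [x |-> p + m / (k (x - p))] that carries the
    vertices to the points [U], [V], [W]. *)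
Definition hagge_coeff (k x y z p : C) : C :=
  k * (p * p - (x + y + z) * p + (x * y + y * z + z * x)) - x * y * z * p^*.

(** Substituting [n^* (x - p) = x p^* - k] for the second intersection into the
    reflection formula gives an expression symmetric in [x, y, z]. *)
Lemma hagge_point_inversion (G : circle) (X Y Z P N U : C) (k : C) :
  let x := X - centre G in let y := Y - centre G in
  let z := Z - centre G in let p := P - centre G in
  k = RtoC (radius G * radius G) ->
  P <> X -> Y <> Z -> on_circle G X -> on_circle G Y -> on_circle G Z ->
  is_second_intersection G X P N -> is_reflection (line_through Y Z) N U ->
  k * ((U - P) * (x - p)) = hagge_coeff k x y z p.
Proof.
  intros x y z p Hk PX YZ GX GY GZ HN HU.
  apply second_intersection_conj in HN; [|easy..].
  rewrite on_circle_conj, <- Hk in GX, GY, GZ.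
  pose proof (reflection_in_chord Y Z N U _ k YZ GY GZ HU) as E.
  fold x in GX, HN. fold y z in E.
  apply (f_equal Cconj) in HN. revert HN. rewrite !(Cmult_conj), !Cconj_conj.
  replace (P - X) with (p - x) by (unfold p, x; ring).
  replace (X - P) with (x - p) by (unfold p, x; ring).
  intros HN.
  replace (U - P) with (U - centre G - p) by (unfold p; ring).
  transitivity (k * (U - centre G) * (x - p) - k * p * (x - p)); [ring|].
  rewrite E.
  transitivity (k * (y + z - p) * (x - p)
    + y * z * ((N - centre G)^* * (p - x))); [ring|].
  rewrite HN. unfold hagge_coeff. rewrite <- GX. push_conj. ring.
Qed.

(** Sylvester's relation: [P - A] is the sum of two radius vectors of equal
    length, hence is orthogonal to their difference. *)
Lemma orthocentre_of_sum (o X Y Z P k : C) :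
  (X - o) * (X - o)^* = k -> (Y - o) * (Y - o)^* = k ->
  (Z - o) * (Z - o)^* = k ->
  P - o = (X - o) + (Y - o) + (Z - o) -> is_orthocentre X Y Z P.
Proof.
  intros HX HY HZ HP.
  assert (key : forall A B C' : C, P - A = (B - o) + (C' - o) ->
    (B - o) * (B - o)^* = k -> (C' - o) * (C' - o)^* = k ->
    dot (psub P A) (psub B C') = 0%R).
  { intros A B C' E HB HC.
    change (dot (P - A)%C (B - C')%C = 0%R). 
    assert (F : RtoC (2 * dot (P - A) (B - C')) = 0).
    { rewrite dot_conj, E.
      transitivity (2 * ((B - o) * (B - o)^* - (C' - o) * (C' - o)^*)).
      - push_conj. ring.
      - rewrite HB, HC. ring. }
    injection F. lra. }
  repeat split; apply key; try easy;
    (match goal with |- _ - ?A = _ =>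
       transitivity (P - o - (A - o)); [ring|rewrite HP; ring] end).
Qed.

(** Eliminating the terms in [p^* p^*] and [p^*] between [m] and [m^*] leaves
    [k^2 (k - |p|^2) (x + y + z - p)]. So [m] can vanish only at the orthocentre
    or on the circle, and there it vanishes only at the vertices. *)
Lemma hagge_coeff_eq_0 (k x y z p : C) :
  k <> 0 -> x * x^* = k -> y * y^* = k -> z * z^* = k -> k^* = k ->
  p <> x -> p <> y -> p <> z ->
  hagge_coeff k x y z p = 0 -> p = x + y + z.
Proof.
  intros Hk Hx Hy Hz kR px py pz M0.
  assert (M1 : x * y * z * (hagge_coeff k x y z p)^*
    + k * p^* * hagge_coeff k x y z p
    = k * k * ((k - p * p^*) * (x + y + z - p))).
  { unfold hagge_coeff. push_conj. rewrite kR.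
    assert (L : x^* = k / x /\ y^* = k / y /\ z^* = k / z
      /\ x <> 0 /\ y <> 0 /\ z <> 0).
    { assert (L : forall v : C, v * v^* = k -> v <> 0 /\ v^* = k / v).
      { intros v Hv. assert (v <> 0) by (intros ->; apply Hk; rewrite <- Hv; ring).
        split; [easy|]. rewrite <- Hv. field. easy. }
      destruct (L x Hx), (L y Hy), (L z Hz). tauto. }
    destruct L as (-> & -> & -> & ? & ? & ?). field. easy. }
  rewrite M0, Cconj_RtoC, !Cmult_0_r, Cplus_0_l in M1.
  symmetry in M1. apply Cmult_eq_0 in M1 as [E|E].
  { apply Cmult_eq_0 in E as [E|E]; easy. }
  apply Cmult_eq_0 in E as [E|E].
  - (* on the circle the coefficient factors as p^* (p - x) (p - y) (p - z) *)
    exfalso.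
    assert (E' : k = p * p^*).
    { transitivity (k - p * p^* + p * p^*); [ring|rewrite E; ring]. }
    assert (F : p^* * ((p - x) * (p - y) * (p - z)) = 0).
    { rewrite <- M0. unfold hagge_coeff. rewrite E'. ring. }
    apply Cmult_eq_0 in F as [F|F].
    { apply Hk. rewrite E', F. ring. }
    apply Cmult_eq_0 in F as [F|F]; [apply Cmult_eq_0 in F as [F|F]|];
      revert F; now apply Cminus_eq_contra.
  - transitivity (x + y + z - (x + y + z - p)); [ring|rewrite E; ring].
Qed.

(** * The centre of the Hagge circle *)

(** From [k w (x - p) = m] one gets [k w p + m = k w x], whose squared modulus
    with [x x^* = k] is the equation of the image circle. *)
Lemma inverse_of_circle (k x p w m : C) :
  k <> 0 -> x * x^* = k -> k^* = k -> k * (w * (x - p)) = m ->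
  k * k * ((p * p^* - k) * (w * w^*)) + k * (p^* * m) * w^*
    + k * (p * m^*) * w = - (m * m^*).
Proof.
  intros Hk Hx kR Hm. rewrite <- Hm. push_conj. rewrite kR. rewrite <- Hx. ring.
Qed.

(** The Hagge circle and the image of [G] share three distinct points, so their
    centres agree. For [P] on [G] the image would be a line, which a circle
    cannot meet three times; hence [k <> p p^*]. *)
Lemma hagge_centre (G K : circle) (X Y Z P : C) :
  let k := RtoC (radius G * radius G) in
  let x := X - centre G in let y := Y - centre G in
  let z := Z - centre G in let p := P - centre G in
  X <> Y -> X <> Z -> Y <> Z ->
  on_circle G X -> on_circle G Y -> on_circle G Z ->
  P <> X -> P <> Y -> P <> Z -> ~ is_orthocentre X Y Z P ->
  is_Hagge_circle X Y Z P K ->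
  k <> p * p^* /\
  k * ((k - p * p^*) * (centre K - P)) = p^* * hagge_coeff k x y z p.
Proof.
  intros k x y z p XY XZ YZ GX GY GZ PX PY PZ PH
    (G0 & X' & Y' & Z' & U & V & W & (G0X & G0Y & G0Z) & HX & HY & HZ
     & HU & HV & HW & KU & KV & KW).
  destruct (circle_eq_of_three_points G G0 X Y Z) as [Eo Er]; try easy.
  assert (kR : k^* = k) by apply Cconj_RtoC.
  assert (k0 : k <> 0).
  { intros E. injection E. pose proof (radius_pos G). nra. }
  assert (Ek : k = RtoC (radius G0 * radius G0)) by now rewrite Er.
  apply (hagge_point_inversion G0 X Y Z P X' U k) in HX; auto.
  apply (hagge_point_inversion G0 Y Z X P Y' V k) in HY; auto.
  apply (hagge_point_inversion G0 Z X Y P Z' W k) in HZ; auto.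
  rewrite Eo in HX, HY, HZ. fold x y z p in HX, HY, HZ.
  set (m := hagge_coeff k x y z p) in *.
  replace (hagge_coeff k y z x p) with m in HY
    by (unfold m, hagge_coeff; ring).
  replace (hagge_coeff k z x y p) with m in HZ
    by (unfold m, hagge_coeff; ring).
  apply on_circle_conj in GX, GY, GZ. fold k x y z in GX, GY, GZ.
  assert (shift : forall M N : C, M <> N -> M - centre G <> N - centre G).
  { intros M N H E. apply H.
    transitivity (M - centre G + centre G); [ring|]. rewrite E. ring. }
  assert (m0 : m <> 0).
  { intros E. apply PH, (orthocentre_of_sum (centre G) X Y Z P k); try easy.
    apply (hagge_coeff_eq_0 k); try easy; now apply shift. }
  (* u - P = m / (k (x - p)) is an injective function of x *)
  assert (inj : forall (a b : C) (S T : C), a <> b ->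
    k * ((S - P) * (a - p)) = m -> k * ((T - P) * (b - p)) = m -> S <> T).
  { intros a b S T ab HS HT E. subst T.
    destruct (Cmult_eq_0 (k * (S - P)) (a - b)) as [F|F].
    - transitivity (k * ((S - P) * (a - p)) - k * ((S - P) * (b - p))); [ring|].
      rewrite HS, HT; ring.
    - apply m0. rewrite <- HS, Cmult_assoc, F. ring.
    - revert F. now apply Cminus_eq_contra. }
  assert (key : forall (a S : C), a * a^* = k ->
    k * ((S - P) * (a - p)) = m ->
    k * k * (p * p^* - k) * ((S - P) * (S - P)^*)
      + k * (p^* * m) * (S - P)^* + (k * (p^* * m))^* * (S - P) = - (m * m^*)).
  { intros a S Ha HS.
    rewrite <- (inverse_of_circle k a p (S - P) m); try easy.
    push_conj. rewrite kR. ring. }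
  assert (E : k * (p^* * m) + k * k * (p * p^* - k) * (centre K - P) = 0).
  { apply (circle_centre_of_equation K U V W P _ _ (- (m * m^*))); try easy.
    - apply (inj x y); auto. now apply shift.
    - apply (inj x z); auto. now apply shift.
    - apply (inj y z); auto. now apply shift.
    - push_conj. rewrite kR. ring.
    - now apply (key x).
    - now apply (key y).
    - now apply (key z). }
  assert (F : k * ((k - p * p^*) * (centre K - P)) = p^* * m).
  { apply Cmult_cancel_l with k; [easy|].
    transitivity (k * (p^* * m)
      - (k * (p^* * m) + k * k * (p * p^* - k) * (centre K - P))); [ring|].
    rewrite E. ring. }
  split; [|exact F].
  intros kp.
  assert (F' : p^* * m = 0).
  { rewrite <- F, <- kp. ring. }
  apply Cmult_eq_0 in F' as [F'|F']; [|easy].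
  apply k0. rewrite kp, F'. ring.
Qed.

(** * The line of centres *)

(** As a function of [p] this is, on dividing by a square root of [a b c d], a
    real quadratic polynomial without [p p^*] term, and it vanishes at [a, b, c, d]
    when these lie on the circle [x x^* = k]: it is the equation of the
    rectangular hyperbola through the four points. *)
Definition circum_hyperbola (k a b c d p : C) : C :=
  k * k * (p * p) - k * k * (a + b + c + d) * p
  + k * k * (a * b + a * c + a * d + b * c + b * d + c * d)
  - k * (a * b * c + a * b * d + a * c * d + b * c * d) * p^*
  + a * b * c * d * (p^* * p^*).

(** The terms of [k^2 m] miss the vertex [d], and those of [a b c d m^*], where
    conjugation turns [s1, s2, s3] into [k s2 / s3, k^2 s1 / s3, k^3 / s3],
    supply exactly the monomials containing [d]. *)
Lemma hagge_coeff_conj_symmetric (k a b c d p : C) :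
  a * a^* = k -> b * b^* = k -> c * c^* = k -> k^* = k ->
  k * k * hagge_coeff k a b c p + a * b * c * d * (hagge_coeff k a b c p)^*
  = k * circum_hyperbola k a b c d p.
Proof.
  intros Ha Hb Hc kR. unfold hagge_coeff, circum_hyperbola.
  push_conj. rewrite kR.
  transitivity (k * k *
      (k * (p * p - (a + b + c) * p + (a * b + b * c + c * a))
       - a * b * c * p^*)
    + d * (k * (a * b * c * (p^* * p^*)
                - ((a * a^*) * b * c + a * (b * b^*) * c + a * b * (c * c^*)) * p^*
                + ((a * a^*) * (b * b^*) * c + a * (b * b^*) * (c * c^*)
                   + (a * a^*) * b * (c * c^*)))
           - (a * a^*) * (b * b^*) * (c * c^*) * p)); [ring|].
  rewrite Ha, Hb, Hc. ring.
Qed.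

(** The right side does not change when [d] is exchanged with a vertex of the
    triangle, so it is the same for the four triangles of a quadrilateral. *)
Lemma hagge_centre_on_line (G K : circle) (X Y Z P d delta : C) :
  let k := RtoC (radius G * radius G) in
  let x := X - centre G in let y := Y - centre G in
  let z := Z - centre G in let p := P - centre G in
  X <> Y -> X <> Z -> Y <> Z ->
  on_circle G X -> on_circle G Y -> on_circle G Z ->
  P <> X -> P <> Y -> P <> Z -> ~ is_orthocentre X Y Z P ->
  is_Hagge_circle X Y Z P K ->
  k * k * delta = x * y * z * d * delta^* ->
  k * k * (k - p * p^*) *
    (p^* * delta * (centre K - P)^* + (p^* * delta)^* * (centre K - P))
  = p * p^* * delta^* * circum_hyperbola k x y z d p.
Proof.
  intros k x y z p XY XZ YZ GX GY GZ PX PY PZ PH HK Hd.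
  assert (kR : k^* = k) by apply Cconj_RtoC.
  assert (k0 : k <> 0).
  { intros E. injection E. pose proof (radius_pos G). nra. }
  destruct (hagge_centre G K X Y Z P) as [_ F]; try easy.
  fold k x y z p in F. set (q := centre K - P) in *.
  pose proof (f_equal Cconj F) as Fc. revert Fc.
  rewrite (Cmult_conj (p^*)), Cconj_conj, !(Cmult_conj k), Cmult_conj,
    Cminus_conj, Cmult_conj, Cconj_conj, kR. intros Fc.
  apply on_circle_conj in GX, GY, GZ. fold k x y z in GX, GY, GZ.
  pose proof (hagge_coeff_conj_symmetric k x y z d p GX GY GZ kR) as B.
  set (m := hagge_coeff k x y z p) in *.
  apply Cmult_cancel_l with k; [easy|].
  transitivity (k * k * (p^* * delta * (k * ((k - p^* * p) * q^*))
      + p * delta^* * (k * ((k - p * p^*) * q)))).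
  { rewrite Cmult_conj, Cconj_conj. ring. }
  rewrite F, Fc.
  transitivity (p * p^* * (k * k * delta * m^* + k * k * delta^* * m)); [ring|].
  rewrite Hd.
  transitivity (p * p^* * delta^* * (k * k * m + x * y * z * d * m^*)); [ring|].
  rewrite B. ring.
Qed.

Lemma collinear4_of_normal (n P Q1 Q2 Q3 Q4 e : C) :
  n <> 0 ->
  (forall Q, Q = Q1 \/ Q = Q2 \/ Q = Q3 \/ Q = Q4 ->
    n * (Q - P)^* + n^* * (Q - P) = e) ->
  collinear4 Q1 Q2 Q3 Q4.
Proof.
  intros n0 H.
  assert (D : (dot n n <> 0)%R).
  { intros D. apply n0. destruct n as [n1 n2]. unfold dot in D; simpl in D.
    assert (n1 = 0 /\ n2 = 0)%R as [-> ->] by (split; nra). easy. }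
  exists (Line Q1 (rot90 n)). cbn [line_dir]. split.
  { intros E. apply n0. destruct n as [n1 n2]. injection E.
    intros -> E2. replace n2 with 0%R by lra. easy. }
  assert (key : forall Q, Q = Q1 \/ Q = Q2 \/ Q = Q3 \/ Q = Q4 ->
    on_line (Line Q1 (rot90 n)) Q).
  { intros Q HQ.
    assert (E : dot n (Q - P) = dot n (Q1 - P)).
    { apply dot_eq_conj. rewrite !H; auto. }
    exists (dot (psub Q Q1) (rot90 n) / dot n n)%R. cbn [line_base line_dir].
    destruct n as [n1 n2], Q as [a b], Q1 as [c d], P as [u v].
    unfold dot, Cminus, Copp, Cplus, psub, padd, pscale, rot90 in *; simpl in *.
    assert (E0 : (n1 * (a - c) + n2 * (b - d) = 0)%R) by lra.
    set (t := ((a + - c) * - n2 + (b + - d) * n1)%R).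
    set (N := (n1 * n1 + n2 * n2)%R) in *.
    f_equal.
    - transitivity (c + t / N * - n2 + n1 * (n1 * (a - c) + n2 * (b - d)) / N)%R.
      + unfold t, N. now field.
      + rewrite E0. unfold t. now field.
    - transitivity (d + t / N * n1 + n2 * (n1 * (a - c) + n2 * (b - d)) / N)%R.
      + unfold t, N. now field.
      + rewrite E0. unfold t. now field. }
  repeat split; apply key; auto.
Qed.

Open Scope R_scope.

Theorem theorem1 :
  forall (Gamma : circle) (A B C D : point),
    A <> B -> A <> C -> A <> D -> B <> C -> B <> D -> C <> D ->
    on_circle Gamma A -> on_circle Gamma B ->
    on_circle Gamma C -> on_circle Gamma D ->
  forall Sigma : hyperbola,
    rectangular Sigma ->
    on_hyperbola Sigma A -> on_hyperbola Sigma B ->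
    on_hyperbola Sigma C -> on_hyperbola Sigma D ->
  forall P : point,
    on_hyperbola Sigma P ->
    P <> A -> P <> B -> P <> C -> P <> D ->
    ~ is_orthocentre B C D P -> ~ is_orthocentre A C D P ->
    ~ is_orthocentre A B D P -> ~ is_orthocentre A B C P ->
  forall Gamma1 Gamma2 Gamma3 Gamma4 : circle,
    is_Hagge_circle B C D P Gamma1 ->
    is_Hagge_circle A C D P Gamma2 ->
    is_Hagge_circle A B D P Gamma3 ->
    is_Hagge_circle A B C P Gamma4 ->
    collinear4 (centre Gamma1) (centre Gamma2) (centre Gamma3) (centre Gamma4).
Proof.
  intros G A B C' D AB AC AD BC BD CD GA GB GC GD _ _ _ _ _ _ P _
    PA PB PC PD H1 H2 H3 H4 K1 K2 K3 K4 HK1 HK2 HK3 HK4.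
  set (k := RtoC (radius G * radius G)). set (o := centre G : C).
  set (a := (A - o)%C). set (b := (B - o)%C). set (c := (C' - o)%C).
  set (d := (D - o)%C). set (p := (P - o)%C).
  assert (k0 : k <> 0).
  { intros E. injection E. pose proof (radius_pos G). nra. }
  destruct (hagge_centre G K4 A B C' P) as [kp F4]; try easy.
  assert (kp' : (k - p * p^*)%C <> 0) by now apply Cminus_eq_contra.
  destruct (Ceq_dec p 0) as [p0|p0].
  - (* the circumcentre is its own Hagge centre for every triangle *)
    assert (key : forall q m : C, (k * ((k - p * p^*) * (q - P)) = p^* * m)%C ->
      (1 * (q - P)^* + 1^* * (q - P))%C = 0).
    { intros q m H. rewrite p0, !Cconj_RtoC in *.
      assert (E : (q - P)%C = 0).
      { apply Cmult_cancel_l with k; [easy|]. apply Cmult_cancel_l with k; [easy|].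
        transitivity (k * ((k - 0 * 0) * (q - P)))%C; [ring|]. rewrite H. ring. }
      rewrite E, Cconj_RtoC. ring. }
    apply (collinear4_of_normal 1 P _ _ _ _ 0).
    { intros E. injection E. lra. }
    intros Q [E|[E|[E|E]]]; rewrite E; eapply key.
    + apply (hagge_centre G K1 B C' D P); easy.
    + apply (hagge_centre G K2 A C' D P); easy.
    + apply (hagge_centre G K3 A B D P); easy.
    + exact F4.
  - set (delta := ((a - b) * (c - d))%C).
    assert (on : forall M : point, on_circle G M -> ((M - o) * (M - o)^*)%C = k).
    { intros M. apply on_circle_conj. }
    assert (Hd : (k * k * delta = a * b * c * d * delta^*)%C).
    { transitivity ((a * a^* * b - b * b^* * a) * (c * c^* * d - d * d^* * c))%C.
      - unfold a at 1 2, b at 2 3, c at 1 2, d at 2 3.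
        rewrite !on by easy. unfold delta. ring.
      - unfold delta. push_conj. ring. }
    assert (dl0 : delta <> 0).
    { unfold delta. apply Cmult_neq_0.
      - replace (a - b)%C with (A - B)%C by (unfold a, b; ring).
        now apply Cminus_eq_contra.
      - replace (c - d)%C with (C' - D)%C by (unfold c, d; ring).
        now apply Cminus_eq_contra. }
    assert (kk : (k * k * (k - p * p^*))%C <> 0).
    { repeat apply Cmult_neq_0; easy. }
    apply (collinear4_of_normal (p^* * delta)%C P _ _ _ _
      (/ (k * k * (k - p * p^*)) *
       (p * p^* * delta^* * circum_hyperbola k a b c d p))%C).
    { apply Cmult_neq_0; [|easy]. intros E. apply p0.
      rewrite <- (Cconj_conj p), E. apply Cconj_RtoC. }
    intros Q HQ. apply Cmult_cancel_l with (k * k * (k - p * p^*))%C; [easy|].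
    rewrite Cmult_assoc, Cinv_r, Cmult_1_l by easy.
    destruct HQ as [E|[E|[E|E]]]; rewrite E.
    + etransitivity; [apply (hagge_centre_on_line G K1 B C' D P a delta); try easy|].
      * fold o b c d k. rewrite Hd. ring.
      * unfold circum_hyperbola. fold o b c d p k. ring.
    + etransitivity; [apply (hagge_centre_on_line G K2 A C' D P b delta); try easy|].
      * fold o a c d k. rewrite Hd. ring.
      * unfold circum_hyperbola. fold o a c d p k. ring.
    + etransitivity; [apply (hagge_centre_on_line G K3 A B D P c delta); try easy|].
      * fold o a b d k. rewrite Hd. ring.
      * unfold circum_hyperbola. fold o a b d p k. ring.
    + now apply (hagge_centre_on_line G K4 A B C' P d delta).
Qed.
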